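(* For all positive integers $d$ and $n$ with $n$ divisible by $d$, $$R(\mathcal A_n^{d})\le 2dn,$$ where $\mathcal A_n^d$ is the alternating $d$-partite ordering of the tight $d$-uniform hyperpath on $n$ vertices.
   Context: An ordered $d$-uniform hypergraph is a $d$-uniform hypergraph with a linear ordering of its vertices; a copy of $\mathcal H$ in $\mathcal G$ is an order-preserving injection of vertices mapping hyperedges to hyperedges. $R(\mathcal G)$ is the minimum $N$ such that every 2-coloring of the hyperedges of the complete ordered $d$-uniform hypergraph on $N$ vertices contains a monochromatic copy of $\mathcal G$. The tight $d$-uniform hyperpath on $n$ vertices $P_n^d$ has vertex set $[n]=\{1,\dots,n\}$ and hyperedges $\{j,j+1,\dots,j+d-1\}$ for $1\le j\le n-d+1$. For $n=dm$, the alternating $d$-partite ordering $\mathcal A_n^d$ is the ordered hypergraph obtained from $P_n^d$ by ordering its vertices as $$1,\,d+1,\,2d+1,\dots,(m-1)d+1,\;\;2,\,d+2,\dots,(m-1)d+2,\;\;\dots,\;\;d,\,2d,\dots,md .$$ *)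

(* Defs.v *)
From mathcomp Require Import all_boot.

Set Implicit Arguments.
Unset Strict Implicit.
Unset Printing Implicit Defensive.

Record hypergraph (d : nat) := Hypergraph {
  vertex :> finType;
  hedges : {set {set vertex}};
  hedges_uniform : forall e, e \in hedges -> #|e| = d
}.

Definition linear_order (T : Type) (le : rel T) : Prop :=
  [/\ total le, antisymmetric le & transitive le].

Record ordered_hypergraph (d : nat) := OrderedHypergraph {
  hgraph :> hypergraph d;
  hle : rel hgraph;
  hle_linear : linear_order hle
}.

Definition hedge d (H : hypergraph d) : Type :=
  {e : {set H} | e \in hedges H}.

Definition is_copy d (G H : ordered_hypergraph d) (f : G -> H) : Prop :=
  [/\ injective f,
      forall x y : G, hle x y -> hle (f x) (f y)
    & forall e : {set G}, e \in hedges G -> f @: e \in hedges H].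

Definition monochromatic d (G H : ordered_hypergraph d)
    (c : hedge H -> bool) (f : G -> H) : Prop :=
  exists b : bool, forall (e : {set G}) (e' : hedge H),
    e \in hedges G -> sval e' = f @: e -> c e' = b.

Lemma complete_uniform d N (e : {set 'I_N}) :
  e \in [set e : {set 'I_N} | #|e| == d] -> #|e| = d.
Proof. by rewrite inE => /eqP. Qed.

Lemma ord_leq_linear N : linear_order (fun x y : 'I_N => x <= y).
Proof.
split=> [x y|x y le_xy|y x z].
- exact: leq_total.
- exact/val_inj/anti_leq.
- exact: leq_trans.
Qed.

Definition complete d N : ordered_hypergraph d :=
  @OrderedHypergraph d (Hypergraph (@complete_uniform d N))
    (fun x y : 'I_N => x <= y) (@ord_leq_linear N).

Definition ramsey_arrow d (N : nat) (G : ordered_hypergraph d) : Prop :=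
  forall c : hedge (complete d N) -> bool,
  exists f : G -> complete d N, is_copy f /\ monochromatic c f.

(* "R(G) exists and equals r". *)
Definition is_ramsey_number d (G : ordered_hypergraph d) (r : nat) : Prop :=
  ramsey_arrow r G /\ forall N : nat, ramsey_arrow N G -> r <= N.

(* Vertices are numbered from 0: the vertex v of [n] is the ordinal v - 1. *)
Definition tight_path_hedges d n : {set {set 'I_n}} :=
  [set [set i : 'I_n | j <= i < j + d] | j : 'I_n.+1 & j + d <= n].

Lemma tight_path_uniform d n (e : {set 'I_n}) :
  e \in tight_path_hedges d n -> #|e| = d.
Proof.
case/imsetP=> j; rewrite inE => le_jd_n ->.
have lt_n (k : 'I_d) : j + k < n.
  by apply: leq_trans le_jd_n; rewrite ltn_add2l.
pose h k := Ordinal (lt_n k).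
have h_inj : injective h.
  by move=> k l /(congr1 val) /= /addnI /val_inj.
rewrite -[RHS](card_ord d) -(card_imset _ h_inj).
apply: eq_card => i; rewrite inE; apply/idP/imsetP => [|[k _ ->]] /=.
  case/andP=> le_ji lt_i.
  have lt_ij : i - j < d by rewrite ltn_subLR.
  by exists (Ordinal lt_ij) => //; apply: val_inj; rewrite /= subnKC.
by rewrite leq_addr ltn_add2l ltn_ord.
Qed.

Definition tight_path d n : hypergraph d :=
  Hypergraph (@tight_path_uniform d n).

(* With m = n / d, the 0-based listing
   0, d, ..., (m-1)d,  1, d+1, ..., (m-1)d+1,  ...,  d-1, 2d-1, ..., md-1. *)
Definition alternating_seq d n : seq nat :=
  [seq q * d + r | r <- iota 0 d, q <- iota 0 (n %/ d)].

Definition alternating_le d n : rel 'I_n :=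
  fun x y => index (val x) (alternating_seq d n)
             <= index (val y) (alternating_seq d n).

Lemma mem_alternating_seq d n (x : 'I_n) :
  d %| n -> val x \in alternating_seq d n.
Proof.
move=> dvd_dn; have d_gt0 : 0 < d.
  by case: d dvd_dn x => // /[!dvd0n] /eqP -> [].
apply/allpairsP; exists (x %% d, x %/ d); split=> /=.
- by rewrite mem_iota ltn_mod.
- by rewrite mem_iota ltn_divLR // divnK // ltn_ord.
- exact: divn_eq.
Qed.

Lemma alternating_le_linear d n :
  d %| n -> linear_order (@alternating_le d n).
Proof.
move=> dvd_dn; split=> [x y|x y /anti_leq eq_xy|y x z].
- exact: leq_total.
- by apply: val_inj; apply: (index_inj 0 _ _ eq_xy); exact: mem_alternating_seq.
- exact: leq_trans.
Qed.

Definition alternating_path d n (dvd_dn : d %| n) : ordered_hypergraph d :=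
  @OrderedHypergraph d (tight_path d n) (@alternating_le d n)
    (alternating_le_linear dvd_dn).

(* Main.v *)
Require Import Defs.
From mathcomp Require Import all_boot zify.
From Stdlib Require Import Classical_Prop.

Set Implicit Arguments.
Unset Strict Implicit.
Unset Printing Implicit Defensive.

(** Write [M = 2 * n] and cut the [d * M] vertices into [d] consecutive blocks
    of size [M].  A transversal edge, one vertex per block, is a point of the
    grid [M ^ d].  In a copy of the alternating path that sends each residue
    class modulo [d] to its own block, the edge starting at [t.+1] arises from
    the edge starting at [t] by replacing the vertex in block [t %% d] by a
    larger vertex of the same block.  So a monochromatic copy is a walk of
    [n - d] steps in the grid, the [t]-th step increasing exactly the
    coordinate [t %% d], that stays inside one colour class.

    Such walks exist in every dense subset [E] of the grid ([increasing_walk]):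
    on each line in a given direction, discard the last point of [E]; this
    loses at most [M ^ (d - 1)] points ([card_extendable]), and every remaining
    point can step to a point of [E] in that direction.  Hence
    [(n - d) * M ^ (d - 1) < #|E|] suffices, and the larger colour class has at
    least [M ^ d / 2 = n * M ^ (d - 1)] points.  The walk is turned back into
    an order-preserving map in [transversal_copy]. *)

(** * Increasing walks in dense subsets of a grid *)

Definition raises d M (i : 'I_d) (x y : {ffun 'I_d -> 'I_M}) : bool :=
  (x i < y i) && [forall j, (j != i) ==> (x j == y j)].

Definition extendable d M (i : 'I_d) (E : {set {ffun 'I_d -> 'I_M}}) :=
  [set x in E | [exists y in E, raises i x y]].

(** Two points of [E] on a common line in direction [i] cannot both fail to be
    extendable, so the others are determined by their coordinates off [i]. *)
Lemma card_extendable d M (i : 'I_d) (E : {set {ffun 'I_d -> 'I_M}}) :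
  #|E| <= #|extendable i E| + M ^ d.-1.
Proof.
have sub_E : extendable i E \subset E by apply/subsetP => x /setIdP[].
rewrite -(cardsID (extendable i E) E) (setIidPr sub_E) leq_add2l.
pose off (x : {ffun 'I_d -> 'I_M}) := [ffun k => x (lift i k)].
have off_inj : {in E :\: extendable i E &, injective off}.
  move=> x y; rewrite !inE => /andP[x_last xE] /andP[y_last yE] eq_off.
  have eq_j j : j != i -> x j = y j.
    move=> ne_ji; case: (unliftP i j) ne_ji => [k ->|->]; last by rewrite eqxx.
    by have /ffunP/(_ k) := eq_off; rewrite !ffunE.
  have last_le u v : u \in E -> v \in E -> (forall j, j != i -> u j = v j) ->
      ~~ ((u \in E) && [exists y in E, raises i u y]) -> v i <= u i.
    move=> uE vE eq_uv; rewrite uE /= negb_exists => /forallP/(_ v).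
    rewrite vE /= /raises negb_and -leqNgt => /orP[//|/forallP[] j].
    by apply/implyP => /eq_uv ->.
  apply/ffunP => j; have [->|/eq_j //] := eqVneq j i.
  apply: val_inj; apply/eqP; rewrite eqn_leq; apply/andP; split.
    by apply: last_le => // k /eq_j.
  by apply: last_le.
rewrite -(card_in_imset off_inj); apply: leq_trans (max_card _) _.
by rewrite card_ffun !card_ord.
Qed.

Lemma increasing_walk d M (dir : nat -> 'I_d) T (E : {set {ffun 'I_d -> 'I_M}}) :
  T * M ^ d.-1 < #|E| ->
  exists w : nat -> {ffun 'I_d -> 'I_M},
    (forall t, t <= T -> w t \in E) /\
    (forall t, t < T -> raises (dir t) (w t) (w t.+1)).
Proof.
elim: T E => [|T IHT] E.
  rewrite mul0n card_gt0 => /set0Pn[x xE].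
  by exists (fun=> x); split.
rewrite mulSn => E_big; have le_E := card_extendable (dir T) E.
(* The last direction is pruned first, so that the end of the shorter walk
   can be extended. *)
case: (IHT (extendable (dir T) E)) => [|w [wE w_raises]]; first by lia.
have /setIdP[_ /exists_inP[y yE Ty]] := wE T (leqnn T).
exists (fun t => if t <= T then w t else y); split=> t le_tT.
  by case: ifP => // /wE /setIdP[].
rewrite -ltnS le_tT; case: ltnP => [/w_raises //|le_Tt].
by have -> : t = T by lia.
Qed.

(** * Walks cycling through the coordinates *)

Lemma ltn_eqmod d u v : u < v -> u = v %[mod d] -> u + d <= v.
Proof.
move=> lt_uv /esym/eqP; rewrite (eqn_mod_dvd d (ltnW lt_uv)) => /dvdn_leq.
by rewrite subn_gt0 (leq_subRL d (ltnW lt_uv)); apply.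
Qed.

Definition cyclic_dir d (d_gt0 : 0 < d) (t : nat) : 'I_d :=
  Ordinal (ltn_pmod t d_gt0).

Definition cyclic_walk d M (d_gt0 : 0 < d) T
    (w : nat -> {ffun 'I_d -> 'I_M}) : Prop :=
  forall t, t < T -> raises (cyclic_dir d_gt0 t) (w t) (w t.+1).

Lemma cyclic_walk_leq d M (d_gt0 : 0 < d) T (w : nat -> {ffun 'I_d -> 'I_M}) i s t :
  cyclic_walk d_gt0 T w -> s <= t -> t <= T -> w s i <= w t i.
Proof.
move=> walk_w; elim: t => [|t IHt]; first by rewrite leqn0 => /eqP ->.
rewrite leq_eqVlt => /orP[/eqP -> //|lt_st lt_tT].
apply: leq_trans (IHt lt_st (ltnW lt_tT)) _.
have /andP[lt_w /forallP/(_ i)] := walk_w t lt_tT.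
by have [->|_ /eqP ->] := eqVneq i (cyclic_dir d_gt0 t); first by rewrite ltnW.
Qed.

(** The coordinate [v %% d] is changed only by steps congruent to [v] modulo
    [d], and none of these occurs from [s] to [t], as [v - d < s] and [t <= v]. *)
Lemma cyclic_walk_const d M (d_gt0 : 0 < d) T (w : nat -> {ffun 'I_d -> 'I_M}) v s t :
  cyclic_walk d_gt0 T w -> s <= t -> t <= T -> t <= v -> v < s + d ->
  w t (cyclic_dir d_gt0 v) = w s (cyclic_dir d_gt0 v).
Proof.
move=> walk_w; elim: t => [|t IHt]; first by rewrite leqn0 => /eqP ->.
rewrite leq_eqVlt => /orP[/eqP -> //|lt_st lt_tT lt_tv lt_vd].
rewrite -IHt //; try by rewrite ltnW.
have /andP[_ /forallP/(_ (cyclic_dir d_gt0 v))] := walk_w t lt_tT.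
case: eqVneq => [|_ /eqP -> //] /(congr1 val) /= /esym /(ltn_eqmod lt_tv) le_tdv.
by lia.
Qed.

(** The edges containing the path vertex [v] start between [v - (d - 1)] and
    [v]; all of them give [v] the same coordinate, and truncated subtraction makes
    the first of them legitimate also for [v < d]. *)
Definition walk_coord d M (d_gt0 : 0 < d) (w : nat -> {ffun 'I_d -> 'I_M}) v :=
  w (v - d.-1) (cyclic_dir d_gt0 v).

Lemma walk_coordE d M (d_gt0 : 0 < d) T (w : nat -> {ffun 'I_d -> 'I_M}) v t :
  cyclic_walk d_gt0 T w -> t <= T -> t <= v -> v < t + d ->
  w t (cyclic_dir d_gt0 v) = walk_coord d_gt0 w v.
Proof. by move=> walk_w *; apply: (cyclic_walk_const walk_w); lia. Qed.

(** Between the last edge containing [u] and the first containing [v], the walk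
    makes step [u], which strictly raises the coordinate [u %% d]. *)
Lemma walk_coord_ltn d M (d_gt0 : 0 < d) T (w : nat -> {ffun 'I_d -> 'I_M}) u v :
  cyclic_walk d_gt0 T w -> v < T + d -> u < v -> u = v %[mod d] ->
  walk_coord d_gt0 w u < walk_coord d_gt0 w v.
Proof.
move=> walk_w lt_vT lt_uv eq_uv.
have le_udv := ltn_eqmod lt_uv eq_uv.
have {eq_uv} eq_dir : cyclic_dir d_gt0 v = cyclic_dir d_gt0 u by apply: val_inj.
rewrite -(walk_coordE (t := u) walk_w); try lia.
have lt_uT : u < T by lia.
have /andP[lt_w _] := walk_w u lt_uT.
apply: leq_trans lt_w _; rewrite /walk_coord.
by rewrite eq_dir; apply: (cyclic_walk_leq _ walk_w); lia.
Qed.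

(** * The alternating order *)

(** The listing of the alternating order is the row-major listing of the pairs
    (residue, quotient), so relabelling it by row-major rank gives [iota]. *)
Lemma index_alternating_seq d n (x : 'I_n) :
  d %| n -> index (val x) (alternating_seq d n) = x %% d * (n %/ d) + x %/ d.
Proof.
move=> dvd_dn; have /= x_in := mem_alternating_seq x dvd_dn.
set s := alternating_seq d n in x_in *; set m := n %/ d.
pose rank v := v %% d * m + v %/ d.
have map_rank : map rank s = iota 0 (d * m).
  rewrite /s /alternating_seq map_allpairs.
  transitivity [seq r * m + q | r <- iota 0 d, q <- iota 0 m].
    apply/eq_in_allpairs => r q; rewrite !mem_iota /= add0n => lt_rd _.
    have d_gt0 : 0 < d by apply: leq_ltn_trans lt_rd.
    by rewrite /rank modnMDl divnMDl // modn_small // divn_small // addn0.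
  elim: (d) => [//|k IHk]; rewrite -addn1 iotaD allpairs_cat IHk.
  rewrite /= cats0 !add0n mulnDl mul1n iotaD add0n.
  by rewrite -[X in _ = _ ++ iota X m]addn0 iotaDl.
have lt_is : index (val x) s < size s by rewrite index_mem.
have lt_dm : index (val x) s < d * m by rewrite -(size_iota 0 (d * m)) -map_rank size_map.
have := nth_map 0 0 rank lt_is.
by rewrite map_rank nth_iota // nth_index // add0n.
Qed.

(** * From walks to copies *)

Lemma block_vertex_subproof d M (i : 'I_d) (a : 'I_M) : i * M + a < d * M.
Proof.
apply: (@leq_trans (i.+1 * M)); last by rewrite leq_mul2r ltn_ord orbT.
by rewrite mulSn addnC ltn_add2r.
Qed.

Definition block_vertex d M (i : 'I_d) (a : 'I_M) : 'I_(d * M) :=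
  Ordinal (block_vertex_subproof i a).

Lemma block_vertex_inj d M (i j : 'I_d) (a b : 'I_M) :
  block_vertex i a = block_vertex j b -> i = j /\ a = b.
Proof.
have M_gt0 : 0 < M by case: (M) a => [[]|].
move/(congr1 val) => /= eq_v; split; apply: val_inj => /=.
  by have := congr1 (divn^~ M) eq_v; rewrite !divnMDl // !divn_small // !addn0.
by have := congr1 (modn^~ M) eq_v; rewrite !modnMDl !modn_small.
Qed.

Definition transversal d M (x : {ffun 'I_d -> 'I_M}) : {set 'I_(d * M)} :=
  [set block_vertex i (x i) | i : 'I_d].

(** The path vertex [v] goes to block [v %% d], at the position which the walk
    gives it.  Blocks follow the residues and positions increase along a residue
    class, which is the lexicographic description of the alternating order. *)
Lemma transversal_copy d n M (d_gt0 : 0 < d) (dvd_dn : d %| n)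
    (w : nat -> {ffun 'I_d -> 'I_M}) :
  d <= n -> cyclic_walk d_gt0 (n - d) w ->
  exists f : alternating_path dvd_dn -> complete d (d * M),
    is_copy f /\
    forall e, e \in hedges (alternating_path dvd_dn) ->
      exists2 t, t <= n - d & f @: e = transversal (w t).
Proof.
move=> le_dn walk_w.
pose f (v : 'I_n) := block_vertex (cyclic_dir d_gt0 v) (walk_coord d_gt0 w v).
have coord_lt (x y : 'I_n) : x < y -> x = y %[mod d] ->
    walk_coord d_gt0 w x < walk_coord d_gt0 w y.
  by apply: (walk_coord_ltn walk_w); rewrite subnK // ltn_ord.
have f_inj : injective f.
  move=> x y /block_vertex_inj[/(congr1 val) /= eq_mod eq_coord].
  apply: val_inj => /=; case: (ltngtP x y) => // lt_xy.
    by have := coord_lt _ _ lt_xy eq_mod; rewrite eq_coord ltnn.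
  by have := coord_lt _ _ lt_xy (esym eq_mod); rewrite eq_coord ltnn.
have f_edge (e : {set 'I_n}) : e \in tight_path_hedges d n ->
    exists2 t, t <= n - d & f @: e = transversal (w t).
  move=> e_edge; have card_e := tight_path_uniform e_edge.
  case/imsetP: e_edge => t; rewrite inE => le_td_n def_e.
  exists t; first by lia.
  (* One inclusion suffices: f is injective, and a transversal has at most d
     vertices. *)
  apply/eqP; rewrite eqEcard; apply/andP; split.
    apply/subsetP => _ /imsetP[v v_e ->]; move: v_e.
    rewrite def_e inE => /andP[le_tv lt_vt].
    apply/imsetP; exists (cyclic_dir d_gt0 v) => //.
    by rewrite /f (walk_coordE walk_w) //; lia.
  rewrite (card_imset _ f_inj) card_e; apply: leq_trans (leq_imset_card _ _) _.
  by rewrite cardT size_enum_ord.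
exists f; split=> //; split=> // [x y|e e_edge]; last first.
  by rewrite inE card_imset // (tight_path_uniform e_edge).
rewrite /= /alternating_le !index_alternating_seq // => le_xy.
have lt_div (z : 'I_n) : z %/ d < n %/ d by rewrite ltn_divRL // (leq_ltn_trans (leq_divM _ _)).
case: (ltngtP (x %% d) (y %% d)) => [lt_mod|lt_mod|eq_mod].
- apply: (@leq_trans ((x %% d).+1 * M)); first by rewrite mulSn addnC leq_add2r ltnW.
  by apply: leq_trans (leq_addr _ _); rewrite leq_mul2r lt_mod orbT.
- have := leq_trans (leq_addr _ _) le_xy; rewrite leqNgt => /negP[].
  apply: (@leq_trans ((y %% d).+1 * (n %/ d))); last by rewrite leq_mul2r lt_mod orbT.
  by rewrite mulSn addnC ltn_add2r.
- rewrite eq_mod leq_add2l; move: le_xy; rewrite eq_mod leq_add2l => le_div.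
  have : x <= y.
    by rewrite (divn_eq x d) (divn_eq y d) eq_mod leq_add2r leq_mul2r le_div orbT.
  rewrite leq_eqVlt => /orP[/eqP/val_inj -> //|lt_xy].
  exact: ltnW (coord_lt _ _ lt_xy eq_mod).
Qed.

(** * The upper bound *)

Lemma alternating_path_arrow d n (d_gt0 : 0 < d) (n_gt0 : 0 < n)
    (dvd_dn : d %| n) :
  ramsey_arrow (d * (2 * n)) (alternating_path dvd_dn).
Proof.
move=> c; set M := 2 * n.
(* Extending c to all vertex sets avoids carrying proofs of uniformity; the
   default value is never met on the edges of the copy. *)
pose colour (e : {set complete d (d * M)}) : bool :=
  oapp c false (insub e : option (hedge (complete d (d * M)))).
pose E b := [set x : {ffun 'I_d -> 'I_M} | colour (transversal x) == b].
have le_dn : d <= n by apply: dvdn_leq.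
have [b E_big] : exists b, (n - d) * M ^ d.-1 < #|E b|.
  have : #|E true| + #|E false| = M * M ^ d.-1.
    have <- : #|{ffun 'I_d -> 'I_M}| = M * M ^ d.-1.
      by rewrite card_ffun !card_ord -expnS prednK.
    rewrite -(cardsC (E true)); congr (_ + _).
    by apply: eq_card => x; rewrite !inE; case: (colour _).
  have : 0 < M ^ d.-1 by rewrite expn_gt0 muln_gt0 n_gt0.
  have : (n - d) * M ^ d.-1 + d * M ^ d.-1 = n * M ^ d.-1 by rewrite -mulnDl subnK.
  have -> : M * M ^ d.-1 = n * M ^ d.-1 + n * M ^ d.-1 by rewrite -mulnDl addnn -mul2n.
  move=> split_n K_gt0 cardE; have : 0 < d * M ^ d.-1 by rewrite muln_gt0 d_gt0.
  have [?|?] := ltnP ((n - d) * M ^ d.-1) #|E true|; first by exists true.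
  by exists false; lia.
have [w [wE walk_w]] := increasing_walk (cyclic_dir d_gt0) E_big.
have [f [f_copy f_edge]] := transversal_copy dvd_dn le_dn walk_w.
exists f; split=> //; exists b => e e' /f_edge[t /wE + ->] def_e'.
rewrite inE -def_e' => /eqP <-.
by rewrite /colour -[sval e']/(val e') valK.
Qed.

Lemma ex_least (P : nat -> Prop) k :
  P k -> exists r, [/\ P r, r <= k & forall N, P N -> r <= N].
Proof.
elim/ltn_ind: k => k IHk Pk.
have [[j lt_jk Pj]|no_less] := classic (exists2 j, j < k & P j).
  have [r [Pr le_rj r_min]] := IHk j lt_jk Pj.
  by exists r; split=> //; apply: leq_trans le_rj (ltnW lt_jk).
by exists k; split=> // N PN; rewrite leqNgt; apply/negP => ?; apply: no_less; exists N.
Qed.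

Theorem proposition31 (d n : nat) (d_gt0 : 0 < d) (n_gt0 : 0 < n)
    (dvd_dn : d %| n) :
  exists r : nat,
    is_ramsey_number (alternating_path dvd_dn) r /\ r <= 2 * d * n.
Proof.
have [r [arrow_r le_r r_min]] :=
  ex_least (P := fun N => ramsey_arrow N (alternating_path dvd_dn))
    (alternating_path_arrow d_gt0 n_gt0 dvd_dn).
by exists r; split=> //; rewrite -mulnA mulnCA.
Qed.
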